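(* Let $(G,H)$ be a matched pair of Lie groups with (reflexive) Lie algebras $\mathfrak g,\mathfrak h$. The canonical Poisson bracket on the right trivialized cotangent bundle $(\mathfrak g\bowtie\mathfrak h)^\ast\rtimes(G\bowtie H)$, corresponding to its canonical symplectic structure $\Omega$, of two functions $\mathcal H,\mathcal F$ of $(\mu,\nu,g,h)$ is $$\begin{aligned}\{\mathcal H,\mathcal F\}(\mu,\nu,g,h)={}&\Big\langle T^\ast R_g\Big(\tfrac{\delta\mathcal H}{\delta g}\Big),\tfrac{\delta\mathcal F}{\delta\mu}\Big\rangle-\Big\langle T^\ast R_g\Big(\tfrac{\delta\mathcal F}{\delta g}\Big),\tfrac{\delta\mathcal H}{\delta\mu}\Big\rangle+\Big\langle\mu,\Big[\tfrac{\delta\mathcal H}{\delta\mu},\tfrac{\delta\mathcal F}{\delta\mu}\Big]\Big\rangle\\&+\Big\langle T^\ast\rho_g\Big(\tfrac{\delta\mathcal H}{\delta g}\Big),\tfrac{\delta\mathcal F}{\delta\nu}\Big\rangle-\Big\langle T^\ast\rho_g\Big(\tfrac{\delta\mathcal F}{\delta g}\Big),\tfrac{\delta\mathcal H}{\delta\nu}\Big\rangle+\Big\langle\nu,\Big[\tfrac{\delta\mathcal H}{\delta\nu},\tfrac{\delta\mathcal F}{\delta\nu}\Big]\Big\rangle\\&+\Big\langle g\overset{\ast}{\triangleright}T^\ast_{e_H}R_h\Big(\tfrac{\delta\mathcal H}{\delta h}\Big),\tfrac{\delta\mathcal F}{\delta\nu}\Big\rangle-\Big\langle g\overset{\ast}{\triangleright}T^\ast_{e_H}R_h\Big(\tfrac{\delta\mathcal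 F}{\delta h}\Big),\tfrac{\delta\mathcal H}{\delta\nu}\Big\rangle\\&-\Big\langle\tfrac{\delta\mathcal H}{\delta\mu}\overset{\ast}{\triangleright}\nu,\tfrac{\delta\mathcal F}{\delta\nu}\Big\rangle+\Big\langle\tfrac{\delta\mathcal F}{\delta\mu}\overset{\ast}{\triangleright}\nu,\tfrac{\delta\mathcal H}{\delta\nu}\Big\rangle\\&+\Big\langle\mu,\tfrac{\delta\mathcal H}{\delta\nu}\triangleright\tfrac{\delta\mathcal F}{\delta\mu}\Big\rangle-\Big\langle\mu,\tfrac{\delta\mathcal F}{\delta\nu}\triangleright\tfrac{\delta\mathcal H}{\delta\mu}\Big\rangle.\end{aligned}$$
   Context: A matched pair of Lie groups is a pair $(G,H)$ of Lie groups with a smooth left action $(h,g)\mapsto h\triangleright g$ of $H$ on the manifold $G$ and a smooth right action $(h,g)\mapsto h\triangleleft g$ of $G$ on the manifold $H$, such that $h\triangleright(g_1g_2)=(h\triangleright g_1)\big((h\triangleleft g_1)\triangleright g_2\big)$, $(h_1h_2)\triangleleft g=\big(h_1\triangleleft(h_2\triangleright g)\big)(h_2\triangleleft g)$, $h\triangleright e_G=e_G$, $e_H\triangleleft g=e_H$. The matched pair group $G\bowtie H$ is $G\times H$ with product $(g_1,h_1)(g_2,h_2)=\big(g_1(h_1\triangleright g_2),(h_1\triangleleft g_2)h_2\big)$. Lifted actions. With $\rho_g:H\to G$, $\rho_g(h)=h\triangleright g$; $\rho_h:G\to G$, $\rho_h(g)=h\triangleright g$; $\sigma_g:H\to H$,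 $\sigma_g(h)=h\triangleleft g$: put $\eta\triangleright g=T_{e_H}\rho_g(\eta)\in T_gG$, $h\triangleright\xi=T_{e_G}\rho_h(\xi)\in\mathfrak g$, $\eta\triangleleft g=T_{e_H}\sigma_g(\eta)\in\mathfrak h$. The Lie algebra actions are $\eta\triangleright\xi=\frac{d}{dt}\big|_{0}h_t\triangleright\xi\in\mathfrak g$ (for a curve $h_t$ with $h_0=e_H$, $\dot h_0=\eta$) and $\eta\triangleleft\xi=\frac{d}{dt}\big|_{0}\eta\triangleleft g_t\in\mathfrak h$ (for a curve $g_t$ with $g_0=e_G$, $\dot g_0=\xi$). The Lie algebra of $G\bowtie H$ is $\mathfrak g\bowtie\mathfrak h=\mathfrak g\oplus\mathfrak h$ with $[(\xi_1,\eta_1),(\xi_2,\eta_2)]=\big([\xi_1,\xi_2]+\eta_1\triangleright\xi_2-\eta_2\triangleright\xi_1,\,[\eta_1,\eta_2]+\eta_1\triangleleft\xi_2-\eta_2\triangleleft\xi_1\big)$, and $(\mathfrak g\bowtie\mathfrak h)^\ast=\mathfrak g^\ast\oplus\mathfrak h^\ast$. Dual maps: $\langle\xi\overset{\ast}{\triangleright}\nu,\eta\rangle=\langle\nu,\eta\triangleleft\xi\rangle$ and $\langle g\overset{\ast}{\triangleright}\nu,\eta\rangle=\langle\nu,\eta\triangleleft g\rangle$ for $\xi\in\mathfrak g$, $\eta\in\mathfrak h$, $\nu\in\mathfrak h^\ast$, $g\in G$. $R$ denotes right translation; $T^\ast R_g:T_g^\ast G\to\mathfrak g^\ast$, $T^\ast_{e_H}R_h:T_h^\ast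 H\to\mathfrak h^\ast$ and $T^\ast\rho_g:T^\ast_gG\to\mathfrak h^\ast$ are the duals of $T_{e_G}R_g$, $T_{e_H}R_h$, $T_{e_H}\rho_g$. For every Lie algebra, $\langle\mathrm{ad}^\ast_{x}\mu,y\rangle=-\langle\mu,[x,y]\rangle$; for every Lie group $K$, $\langle\mathrm{Ad}^\ast_k\mu,x\rangle=\langle\mu,\mathrm{Ad}_{k^{-1}}x\rangle$. Symplectic structure. $T^\ast(G\bowtie H)$ is identified with $(\mathfrak g\bowtie\mathfrak h)^\ast\rtimes(G\bowtie H)$ by right trivialization $\alpha_k\mapsto(T_e^\ast R_k\alpha_k,k)$, with group product $(m_1,k_1)(m_2,k_2)=(m_1+\mathrm{Ad}^\ast_{k_1}m_2,k_1k_2)$. Its right invariant vector fields are, for $(\hat\mu,\hat\nu)\in(\mathfrak g\bowtie\mathfrak h)^\ast$ and $(\xi,\eta)\in\mathfrak g\bowtie\mathfrak h$, $X_{(\hat\mu,\hat\nu,\xi,\eta)}(\mu,\nu,g,h)=\big((\hat\mu,\hat\nu)+\mathrm{ad}^\ast_{(\xi,\eta)}(\mu,\nu),\,TR_{(g,h)}(\xi,\eta)\big)$, and the canonical symplectic two-form $\Omega$ is determined by $\Omega(X_{(\hat\mu_1,\hat\nu_1,\xi_1,\eta_1)},X_{(\hat\mu_2,\hat\nu_2,\xi_2,\eta_2)})(\mu,\nu,g,h)=\langle(\hat\mu_2,\hat\nu_2),(\xi_1,\eta_1)\rangle-\langle(\hat\mu_1,\hat\nu_1),(\xi_2,\eta_2)\rangle+\langle(\mu,\nu),[(\xi_1,\eta_1),(\xi_2,\eta_2)]\rangle$.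 The Hamiltonian vector field of $\mathcal H$ is defined by $i_{X_{\mathcal H}}\Omega=d\mathcal H$, and the canonical Poisson bracket is $\{\mathcal H,\mathcal F\}=\Omega(X_{\mathcal H},X_{\mathcal F})$. The partial derivatives are $\frac{\delta\mathcal H}{\delta g}\in T^\ast_gG$, $\frac{\delta\mathcal H}{\delta h}\in T^\ast_hH$, and, by the reflexivity assumption $\mathfrak g^{\ast\ast}=\mathfrak g$, $\mathfrak h^{\ast\ast}=\mathfrak h$, $\frac{\delta\mathcal H}{\delta\mu}\in\mathfrak g$, $\frac{\delta\mathcal H}{\delta\nu}\in\mathfrak h$. *)

(* Defs.v *)
From HB Require Import structures.
From mathcomp Require Import all_boot all_order all_algebra.
From mathcomp Require Import all_classical all_reals all_analysis.

Set Implicit Arguments.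
Unset Strict Implicit.
Unset Printing Implicit Defensive.
Import Order.TTheory GRing.Theory Num.Theory.
Import numFieldNormedType.Exports.
Local Open Scope classical_set_scope.
Local Open Scope ring_scope.

Section dual_def.
Context (R : realType) (E : normedModType R).

Definition dual_pred : {pred E -> R^o} :=
  [pred f : E -> R^o | `[< linear f /\ continuous f >]].

Record dual := Dual { dual_fun :> E -> R^o ; _ : dual_fun \in dual_pred }.

HB.instance Definition _ := [isSub for dual_fun].
HB.instance Definition _ := [Choice of dual by <:].

Lemma dual_predP (f : E -> R^o) :
  reflect (linear f /\ continuous f) (f \in dual_pred).
Proof. by rewrite inE; exact: asboolP. Qed.

Lemma dual_submod_closed : submod_closed dual_pred.
Proof.
split=> [|a f g /dual_predP[lf cf] /dual_predP[lg cg]].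
  apply/dual_predP; split; first by move=> a u v; rewrite scaler0 addr0.
  by move=> x; exact: cvg_cst.
apply/dual_predP; split=> [b u v|x].
  rewrite /= !fctE lf lg !scalerDr !scalerA mulrC addrACA.
  by rewrite -!scalerA.
by apply: cvgD; [apply: cvgZl_tmp; exact: cf | exact: cg].
Qed.

HB.instance Definition _ :=
  GRing.isSubmodClosed.Build R (E -> R^o) dual_pred dual_submod_closed.
HB.instance Definition _ := [SubChoice_isSubLmodule of dual by <:].

Lemma dual_linear (f : dual) : linear f.
Proof. by case: f => f /= /dual_predP[]. Qed.

Lemma dual_continuous (f : dual) : continuous f.
Proof. by case: f => f /= /dual_predP[]. Qed.

Let unit_values (f : dual) : set R := [set `|f x| | x in [set x : E | `|x| <= 1]].

Definition dual_norm (f : dual) : R := sup (unit_values f).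

Let unit_values0 f : unit_values f !=set0.
Proof. by exists `|f 0|, 0 => //=; rewrite normr0. Qed.

Let unit_values_bounded f : has_ubound (unit_values f).
Proof.
pose fL := GRing.isLinear.Build R E R^o *:%R f (dual_linear f).
pose g : {linear E -> R^o} := HB.pack (f : E -> R^o) fL.
have [_ /(_ (@dual_continuous f))] := linear_bounded_continuous g.
move=> /linear_boundedP /pinfty_ex_gt0[r r0 gr].
by exists r => _ /= [x x1 <-]; rewrite (le_trans (gr x))// ler_piMr// ltW.
Qed.

Let dual_norm_ub (f : dual) x : `|x| <= 1 -> `|f x| <= dual_norm f.
Proof. by move=> x1; apply: ub_le_sup => //; exists x. Qed.

Let dual_normD f g : dual_norm (f + g) <= dual_norm f + dual_norm g.
Proof.
apply: ge_sup => // _ /= [x x1 <-].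
by rewrite (le_trans (ler_normD _ _))// lerD// dual_norm_ub.
Qed.

Let dual_normZ (a : R) f : dual_norm (a *: f) = `|a| * dual_norm f.
Proof.
have le_normZ c h : dual_norm (c *: h) <= `|c| * dual_norm h.
  apply: ge_sup => // _ /= [x x1 <-].
  by rewrite [`|_|]normrM ler_wpM2l// dual_norm_ub.
apply/eqP; rewrite eq_le le_normZ /=; have [->|a0] := eqVneq a 0.
  rewrite normr0 mul0r; apply: le_trans (dual_norm_ub (0 *: f) (x := 0) _) => //.
  by rewrite normr0.
rewrite -ler_pdivlMl ?normr_gt0// -normfV.
by rewrite -{1}[f]scale1r -(mulVf a0) -scalerA le_normZ.
Qed.

Let dual_norm_eq0 f : dual_norm f = 0 -> f = 0.
Proof.
move=> f0; apply/val_inj/funext => x /=; apply/eqP.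
have f1 y : `|y| <= 1 -> f y = 0.
  by move=> /dual_norm_ub-/(_ f); rewrite f0 normr_le0 => /eqP.
have fZ (a : R) y : f (a *: y) = a * f y.
  have f00 : f 0 = 0 by rewrite f1// normr0.
  by have := dual_linear f a y 0; rewrite addr0 f00 addr0.
have [->|x0] := eqVneq x 0; first by rewrite f1// normr0.
rewrite -[x]scale1r -(mulfV (x := `|x|)) ?normr_eq0// -scalerA fZ f1 ?mulr0//.
by rewrite normrZ normfV normr_id mulVf ?normr_eq0.
Qed.

HB.instance Definition _ :=
  Lmodule_isNormed.Build R dual dual_normD dual_normZ dual_norm_eq0.

End dual_def.

(** The canonical map of [E] into its bidual is a bijection. *)
Definition reflexive_space (R : realType) (E : normedModType R) : Prop :=
  forall Phi : dual (dual E), exists! x : E, forall f : dual E, Phi f = f x.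

(** The continuous linear functional with the values of [f]; [0] if [f] is not
    linear and continuous. *)
Definition to_dual (R : realType) (E : normedModType R) (f : E -> R) : dual E :=
  xget 0 [set phi : dual E | forall x, phi x = f x].

(** Joint differentiability of [(x, v) |-> 'd f x v] is asked at each step, so
    that only the product norm is needed; [smooth_on] is the usual notion of
    C^oo for Frechet derivatives. *)
Fixpoint diff_on (R : realType) (n : nat) (E F : normedModType R) (U : set E)
    (f : E -> F) : Prop :=
  if n is m.+1 then
    (forall x, U x -> differentiable f x) /\
    @diff_on R m (E * E)%type F (U `*` setT) (fun p => 'd f (fst p) (snd p))
  else forall x, U x -> {for x, continuous f}.

Definition smooth_on (R : realType) (E F : normedModType R) (U : set E)
  (f : E -> F) : Prop := forall n, diff_on n U f.

Record chart (R : realType) (M : topologicalType) (E : normedModType R) := Chart {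
  chart_dom : set M;
  chart_map :> M -> E;
  chart_inv : E -> M }.

Definition is_chart (R : realType) (M : topologicalType) (E : normedModType R)
    (c : chart M E) : Prop :=
  [/\ open (chart_dom c), open (c @` chart_dom c),
      {in chart_dom c, cancel c (chart_inv c)},
      {in chart_dom c, forall x, {for x, continuous c}} &
      {in c @` chart_dom c, forall z, {for z, continuous (chart_inv c)}}].

(** An atlas, indexed by the points: [chart_at x] is a chart around [x]. *)
Record charted (R : realType) := Charted {
  pt :> topologicalType;
  model : normedModType R;
  chart_at : pt -> chart pt model }.

Section manifold.
Context (R : realType).
Implicit Types M N : charted R.

Definition is_manifold M : Prop :=
  [/\ hausdorff_space M,
      forall x : M, is_chart (chart_at x) /\ chart_dom (chart_at x) x &
      forall x y : M,
        smooth_on (chart_at x @` (chart_dom (chart_at x) `&` chart_dom (chart_at y)))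
          (chart_at y \o chart_inv (chart_at x))].

Definition local_expr M N (f : M -> N) (x : M) : model M -> model N :=
  chart_at (f x) \o f \o chart_inv (chart_at x).

Definition smooth M N (f : M -> N) : Prop :=
  continuous f /\
  forall x : M,
    smooth_on
      (chart_at x @` (chart_dom (chart_at x) `&` f @^-1` chart_dom (chart_at (f x))))
      (@local_expr M N f x).

(** [T_x M] is the model space, a tangent vector being identified with its
    coordinates in the chart [chart_at x]. *)
Definition tangent M (x : M) : normedModType R := model M.

Arguments tangent : clear implicits.

(** The differential at [x] in the charts [chart_at x] and [chart_at (f x)]. *)
Definition tmap M N (f : M -> N) (x : M) : tangent M x -> tangent N (f x) :=
  'd (@local_expr M N f x) (chart_at x x).

(** A normed space as a manifold with one chart. *)
Definition vec (E : normedModType R) : charted R :=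
  Charted (fun _ : E => Chart setT id id).

(** The product manifold; its tangent space at a point is the product of the
    tangent spaces of the factors. *)
Definition prod_chart (M N : topologicalType) (E F : normedModType R)
    (c : chart M E) (d : chart N F) : chart (M * N)%type (E * F)%type :=
  Chart (chart_dom c `*` chart_dom d) (fun p => (c p.1, d p.2))
    (fun z => (chart_inv c z.1, chart_inv d z.2)).

Definition prodM M N : charted R :=
  Charted (fun p : (M * N)%type => prod_chart (chart_at p.1) (chart_at p.2)).

(** A vector field around [x], read in the chart [chart_at x]. *)
Definition vf_expr M (X : forall y : M, tangent M y) (x : M) (z : model M) : model M :=
  let y := chart_inv (chart_at x) z in
  'd (chart_at x \o chart_inv (chart_at y)) (chart_at y y) (X y).

Definition vf_bracket M (X Y : forall y : M, tangent M y) (x : M) : tangent M x :=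
  let z := chart_at x x in
  'd (vf_expr Y x) z (vf_expr X x z) - 'd (vf_expr X x) z (vf_expr Y x z).

End manifold.

Arguments tangent {R} M x.
Arguments tmap {R} M N f x.
Arguments smooth {R} M N f.
Arguments vf_bracket {R} M X Y x.

#[short(type="groupTopologicalType")]
HB.structure Definition GroupTopological := {G of Group G & Topological G}.

Record lieGroup (R : realType) := LieGroup {
  lg_sort :> groupTopologicalType;
  lg_model : normedModType R;
  lg_chart : lg_sort -> chart lg_sort lg_model;
  lg_charted := Charted lg_chart;
  lg_manifold : is_manifold lg_charted;
  lg_smooth_mul : smooth (prodM lg_charted lg_charted) lg_charted
    (fun p => (p.1 * p.2)%g);
  lg_smooth_inv : smooth lg_charted lg_charted (fun x => x^-1%g) }.

Coercion lg_charted : lieGroup >-> charted.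

Section lie_algebra.
Context (R : realType) (G : lieGroup R).

Definition lie_algebra : normedModType R := tangent G 1%g.

Definition left_invariant (xi : lie_algebra) (g : G) : tangent G g :=
  tmap G G (fun k : G => (g * k)%g) 1%g xi.

(** The bracket is that of left invariant fields, so that
    [xi1, xi2] = d/dt Ad_{g_t} xi2, with the sign needed by [mp_bracket] and by
    <ad^*_x m, y> = - <m, [x, y]>. *)
Definition lie_bracket (xi1 xi2 : lie_algebra) : lie_algebra :=
  vf_bracket G (left_invariant xi1) (left_invariant xi2) 1%g.

End lie_algebra.

Record matchedPair (R : realType) (G H : lieGroup R) := MatchedPair {
  lact : H -> G -> G;
  ract : H -> G -> H;
  lact_smooth : smooth (prodM H G) G (fun p => lact p.1 p.2);
  ract_smooth : smooth (prodM H G) H (fun p => ract p.1 p.2);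
  lact1 : forall g, lact 1%g g = g;
  lactM : forall h1 h2 g, lact (h1 * h2)%g g = lact h1 (lact h2 g);
  ract1 : forall h, ract h 1%g = h;
  ractM : forall h g1 g2, ract h (g1 * g2)%g = ract (ract h g1) g2;
  lact_mulg : forall h g1 g2,
    lact h (g1 * g2)%g = (lact h g1 * lact (ract h g1) g2)%g;
  ract_mulg : forall h1 h2 g,
    ract (h1 * h2)%g g = (ract h1 (lact h2 g) * ract h2 g)%g;
  lact_one : forall h, lact h 1%g = 1%g;
  ract_one : forall g, ract 1%g g = 1%g }.

Section matched_pair.
Context (R : realType) (G H : lieGroup R) (mp : matchedPair G H).

Local Notation LG := (lie_algebra G).
Local Notation LH := (lie_algebra H).

Definition mpM : charted R := prodM G H.
Definition mp_one : mpM := (1%g, 1%g).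
Definition mp_mul (k1 k2 : mpM) : mpM :=
  ((k1.1 * lact mp k1.2 k2.1)%g, (ract mp k1.2 k2.1 * k2.2)%g).

(** [g], [h] stand for group elements and [v] for Lie algebra elements. The
    values lie in the tangent spaces at [1 |> g = g], [h |> 1 = 1] and
    [1 <| g = 1]; the types agree because [tangent] does not depend on the
    point up to conversion. *)
Definition lact_vg (eta : LH) (g : G) : tangent G g :=
  tmap H G (fun h : H => lact mp h g) 1%g eta.
Definition lact_hv (h : H) (xi : LG) : LG :=
  tmap G G (fun g : G => lact mp h g) 1%g xi.
Definition ract_vg (eta : LH) (g : G) : LH :=
  tmap H H (fun h : H => ract mp h g) 1%g eta.

(** The derivatives at [t = 0] of [h_t |> xi] and [eta <| g_t], for curves
    through [1] with velocity [eta], [xi]. *)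
Definition lact_vv (eta : LH) (xi : LG) : LG :=
  tmap H (vec LG) (fun h : H => lact_hv h xi) 1%g eta.
Definition ract_vv (eta : LH) (xi : LG) : LH :=
  tmap G (vec LH) (fun g : G => ract_vg eta g) 1%g xi.

Definition mp_bracket (x y : LG * LH) : LG * LH :=
  (lie_bracket x.1 y.1 + lact_vv x.2 y.1 - lact_vv y.2 x.1,
   lie_bracket x.2 y.2 + ract_vv x.2 y.1 - ract_vv y.2 x.1).

Definition pairing (m : dual LG * dual LH) (x : LG * LH) : R :=
  m.1 x.1 + m.2 x.2.

Definition mp_coad (x : LG * LH) (m : dual LG * dual LH) : dual LG * dual LH :=
  xget 0 [set m' | forall y, pairing m' y = - pairing m (mp_bracket x y)].

Definition star_v (xi : LG) (nu : dual LH) : dual LH :=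
  to_dual (fun eta : LH => nu (ract_vv eta xi)).
Definition star_g (g : G) (nu : dual LH) : dual LH :=
  to_dual (fun eta : LH => nu (ract_vg eta g)).
Definition cotangent_rho (g : G) (alpha : dual (tangent G g)) : dual LH :=
  to_dual (fun eta : LH => alpha (lact_vg eta g)).

Definition cotriv : charted R :=
  prodM (prodM (vec (dual LG)) (vec (dual LH))) mpM.

Definition right_invariant (m : dual LG * dual LH) (x : LG * LH)
    (p : cotriv) : tangent cotriv p :=
  (m + mp_coad x p.1, tmap mpM mpM (fun k => mp_mul k p.2) mp_one x).

(** The canonical symplectic form: bilinear, alternating, with the prescribed values on
    right invariant fields, which span each tangent space. *)
Definition is_canonical_form
    (Omega : forall p : cotriv, tangent cotriv p -> tangent cotriv p -> R) : Prop :=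
  [/\ forall p v, linear (Omega p v : tangent cotriv p -> R^o),
      forall p v, linear (Omega p ^~ v : tangent cotriv p -> R^o),
      forall p v, Omega p v v = 0 &
      forall m1 x1 m2 x2 p,
        Omega p (right_invariant m1 x1 p) (right_invariant m2 x2 p) =
        pairing m2 x1 - pairing m1 x2 + pairing p.1 (mp_bracket x1 x2)].

Definition Omega (p : cotriv) (v w : tangent cotriv p) : R :=
  xget (fun _ _ _ => 0) is_canonical_form p v w.

Definition hamiltonian_field (F : cotriv -> R^o) (p : cotriv) : tangent cotriv p :=
  xget 0 [set v | forall w, Omega v w = tmap cotriv (vec R^o) F p w].

Definition poisson (F1 F2 : cotriv -> R^o) (p : cotriv) : R :=
  Omega (hamiltonian_field F1 p) (hamiltonian_field F2 p).

End matched_pair.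

(** [T^* R_g : T_g^* G -> g^*] *)
Definition cotangent_right (R : realType) (G : lieGroup R) (g : G)
    (alpha : dual (tangent G g)) : dual (lie_algebra G) :=
  to_dual (fun xi : lie_algebra G => alpha (tmap G G (fun k : G => (k * g)%g) 1%g xi)).

Definition covector (R : realType) (M : charted R) (f : M -> R^o) (x : M) :
    dual (tangent M x) :=
  to_dual (tmap M (vec R^o) f x).

Arguments covector {R} M f x.

(** For a function of a variable in the dual of [E], with [E] reflexive: the
    element of [E] representing the differential at [m]. *)
Definition dual_gradient (R : realType) (E : normedModType R)
    (f : dual E -> R^o) (m : dual E) : E :=
  xget 0 [set x | forall m' : dual E, tmap (vec (dual E)) (vec R^o) f m m' = m' x].

Section partial_derivatives.
Context (R : realType) (G H : lieGroup R) (F : cotriv G H -> R^o).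
Context (mu : dual (lie_algebra G)) (nu : dual (lie_algebra H)) (g : G) (h : H).

Definition d_mu : lie_algebra G :=
  dual_gradient (fun mu' => F ((mu', nu), (g, h))) mu.
Definition d_nu : lie_algebra H :=
  dual_gradient (fun nu' => F ((mu, nu'), (g, h))) nu.
Definition d_g : dual (tangent G g) :=
  covector G (fun g' : G => F ((mu, nu), (g', h))) g.
Definition d_h : dual (tangent H h) :=
  covector H (fun h' : H => F ((mu, nu), (g, h'))) h.

End partial_derivatives.

(* Main.v *)
(** Right invariant vectors exhaust each tangent space of the cotangent bundle,
    because [T R_(g,h)] is triangular with invertible diagonal blocks. So
    [Omega] is determined on all vectors, and [i_X Omega = dF] is solved,
        uniquely
    by reflexivity, by the right invariant vector whose momentum part is
    [- T^* R (dF)] and whose Lie algebra part is the gradient of [F] in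
    [(mu, nu)]. The Poisson bracket is [Omega] of two such vectors.

    The analytic input is that [ad^*] takes values in the continuous dual. The
    brackets of the Lie algebras and the two infinitesimal actions are mixed
    second derivatives at the unit of smooth maps of two variables, hence
    linear and continuous in each argument. *)
Require Import Defs.
From HB Require Import structures.
From mathcomp Require Import all_boot all_order all_algebra.
From mathcomp Require Import all_classical all_reals all_analysis.
From mathcomp Require Import ring.

Import Order.TTheory GRing.Theory Num.Theory.
Import numFieldNormedType.Exports.
Local Open Scope ring_scope.
Local Open Scope classical_set_scope.

Set Implicit Arguments.
Unset Strict Implicit.
Unset Printing Implicit Defensive.

(** * Differentials of functions agreeing near a point, and of projections *)

Section differentials.
Context (R : realType).
Implicit Types E F K X : normedModType R.

(** The first order expansion of [f] at [x] is also one of [g], because the remainder is only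
    examined near [x]; uniqueness of the differential does the rest. *)
Lemma is_diff_near E F (f g : E -> F) (df : E -> F) (x : E) :
  (\near x, f x = g x) -> is_diff x f df -> is_diff x g df.
Proof.
move=> fg [dfx <-].
have [cdf /eqaddoP fE] := (diff_locallyP _ _).1 dfx.
have gE : g \o shift x = cst (g x) + 'd f x +o_ (0 : E) id.
  apply/eqaddoP => e e0; have := fE e e0.
  rewrite (nbhs_singleton fg).
  have : \forall h \near (0 : E), f (h + x) = g (h + x).
    by move: fg; rewrite [X in X -> _](near_shift 0) /= subr0.
  by apply: filterS2 => h /=; rewrite !fctE /= => ->.
have dE : 'd g x = 'd f x :> (E -> F) by exact: diff_unique.
split; last exact: dE.
apply: (diff_locallyP x g).2.
by rewrite dE; exact: (conj cdf gE).
Qed.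

Lemma differentiable_near E F (f g : E -> F) (x : E) :
  (\near x, f x = g x) -> differentiable f x -> differentiable g x.
Proof. by move=> fg df; have [] := is_diff_near fg (differentiableP df). Qed.

Lemma diff_near E F (f g : E -> F) (x : E) :
  (\near x, f x = g x) -> differentiable f x -> 'd g x = 'd f x :> (E -> F).
Proof. by move=> fg df; have [] := is_diff_near fg (differentiableP df). Qed.

Lemma is_diff_fst E F (p : (E * F)%type) : is_diff p fst fst.
Proof.
have cg : continuous (fst : (E * F)%type -> E) by move=> x; exact: cvg_fst.
by split; [exact: (linear_differentiable (f := fst))
          |exact: (diff_lin (f := fst))].
Qed.

Lemma is_diff_snd E F (p : (E * F)%type) : is_diff p snd snd.
Proof.
have cg : continuous (snd : (E * F)%type -> F) by move=> x; exact: cvg_snd.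
by split; [exact: (linear_differentiable (f := snd))
          |exact: (diff_lin (f := snd))].
Qed.

End differentials.

(** * Continuous linear maps and functionals *)

(** A predicate on bare functions, so that it applies to maps such as [lact_vv mp eta], which carry
    no bundled linear structure. *)
Definition clinear (R : realType) (E F : normedModType R) (f : E -> F) : Prop :=
  linear f /\ continuous f.

Section clinear.
Context (R : realType).
Implicit Types E F K : normedModType R.

Lemma clinear_diff E F (f : E -> F) (x : E) :
  differentiable f x -> clinear ('d f x).
Proof. by move=> df; split; [exact: linearP | exact: diff_continuous]. Qed.

Lemma clinearD E F (f g : E -> F) :
  clinear f -> clinear g -> clinear (fun x => f x + g x).
Proof.
move=> [lf cf] [lg cg]; split=> [a x y|x].
  by rewrite lf lg scalerDr addrACA.
by apply: cvgD; [exact: cf | exact: cg].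
Qed.

Lemma clinearN E F (f : E -> F) : clinear f -> clinear (fun x => - f x).
Proof.
move=> [lf cf]; split=> [a x y|x]; first by rewrite lf opprD scalerN.
by apply: cvgN; exact: cf.
Qed.

Lemma clinear_comp E F K (f : E -> F) (g : F -> K) :
  clinear f -> clinear g -> clinear (fun x => g (f x)).
Proof.
move=> [lf cf] [lg cg]; split=> [a x y|x]; first by rewrite lf lg.
by apply: continuous_comp; [exact: cf | exact: cg].
Qed.

Lemma clinear_pair E F K (f : E -> F) (g : E -> K) :
  clinear f -> clinear g -> clinear (fun x => (f x, g x) : (F * K)%type).
Proof.
move=> [lf cf] [lg cg]; split=> [a x y|x]; first by rewrite lf lg.
by apply: cvg_pair; [exact: cf | exact: cg].
Qed.

Lemma clinear_id E : clinear (@id E).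
Proof. by split=> // x; exact: cvg_id. Qed.

Lemma clinear_fst E F : clinear (fst : (E * F)%type -> E).
Proof. by split=> // x; exact: cvg_fst. Qed.

Lemma clinear_snd E F : clinear (snd : (E * F)%type -> F).
Proof. by split=> // x; exact: cvg_snd. Qed.

Lemma clinear_dual E (f : dual E) : clinear (f : E -> R^o).
Proof. by split; [exact: dual_linear | exact: dual_continuous]. Qed.

Lemma clinear0 (E F : normedModType R) (f : E -> F) : clinear f -> f 0 = 0.
Proof.
by move=> [lf _]; have := lf (-1) 0 0; rewrite scaler0 addr0 scaleN1r addNr.
Qed.

Lemma clinear_add (E F : normedModType R) (f : E -> F) (x y : E) :
  clinear f -> f (x + y) = f x + f y.
Proof. by move=> [lf _]; have := lf 1 x y; rewrite !scale1r. Qed.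

Lemma clinear_opp (E F : normedModType R) (f : E -> F) (x : E) :
  clinear f -> f (- x) = - f x.
Proof.
move=> cf; have [lf _] := cf; have := lf (-1) x 0.
by rewrite !scaleN1r !addr0 (clinear0 cf) addr0.
Qed.

(** Packing [f] itself as an element of the dual shows that the choice in [to_dual] does not fall
    back on its default [0]. *)
Lemma to_dualE (E : normedModType R) (f : E -> R^o) :
  clinear f -> to_dual f = f :> (E -> R^o).
Proof.
move=> cf; apply/funext => x; rewrite /to_dual.
have fd : f \in @dual_pred R E by apply/dual_predP.
have := @xgetPex _ 0 [set phi : dual E | forall x, phi x = f x].
by apply; exists (Dual fd).
Qed.

Lemma dual_ext (E : normedModType R) (f g : dual E) : (forall x, f x = g x) ->
    f = g.
Proof. by move=> fg; apply/val_inj/funext. Qed.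

End clinear.

Lemma continuous_pair (T : topologicalType) (E F : topologicalType)
    (f : T -> E) (g : T -> F) (x : T) :
  {for x, continuous f} -> {for x, continuous g} ->
  {for x, continuous (fun y => (f y, g y))}.
Proof. exact: cvg_pair. Qed.

(** * Mixed second derivatives along a two-parameter family *)

Section mixed_derivative.
Context (R : realType) (E F X K : normedModType R).
Context (A : X -> K) (S : set X) (P : E -> F -> X) (i : E -> X) (j : F -> X).
Context (z0 : E) (w0 : F).
Hypotheses (smoothA : smooth_on S A) (nbhsS : nbhs (P z0 w0) S).
Hypotheses (diffl : is_diff z0 (P^~ w0) i) (diffr : forall z, is_diff w0 (P z)
    j).

(** [B] is the inner derivative as a function of the outer variable. [DA] is the derivative as a
    joint function of point and vector, the form in which [smooth_on] provides regularity; the chain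
    rule relates the two near [z0]. *)
Let B (v : F) (z : E) : K := 'd (A \o P z) w0 v.
Let DA (p : (X * X)%type) : K := 'd A (p.1) (p.2).

Let B_near v : \near z0, DA (P z0 w0, j v) = B v z0.
Proof.
have : \forall z \near z0, S (P z w0).
  exact: (differentiable_continuous (@ex_diff _ _ _ _ _ _ _ diffl)).
apply: filterS => z Sz; have [dP Pj] := diffr z.
rewrite /B /DA /= (diff_comp dP ((smoothA 1).1 _ Sz)) /=.
by rewrite Pj.
Qed.

Let is_diff_B v : is_diff z0 (B v) (fun u => 'd DA (P z0 w0, j v) (i u, 0)).
Proof.
apply: is_diff_near (B_near v) _.
have dP : is_diff z0 (fun z => (P z w0, cst (j v) z)) (fun u => (i u, 0)).
  exact: is_diff_pair.
have dDA : is_diff (P z0 w0, cst (j v) z0) DA ('d DA (P z0 w0, j v)).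
  apply: differentiableP; apply: (smoothA 2).2.1.
  by split=> //; exact: nbhs_singleton.
exact: (is_diff_comp dP dDA).
Qed.

Lemma mixed_diff_differentiable v : differentiable (fun z => 'd (A \o P z) w0
    v) z0.
Proof. exact: (@ex_diff _ _ _ _ _ _ _ (is_diff_B v)). Qed.

(** Linearity in [v] is inherited from the inner differential. Continuity comes from writing the
    value as ['d DA] at a point depending continuously on [v], and from the joint continuity of the
    second derivative. *)
Lemma mixed_diff_clinearr u :
  clinear (fun v => 'd (fun z => 'd (A \o P z) w0 v) z0 u).
Proof.
split=> [a v v'|].
  have -> : (fun z => 'd (A \o P z) w0 (a *: v + v')) =
            a *: (fun z => 'd (A \o P z) w0 v) + (fun z => 'd (A \o P z) w0 v').
    by apply/funext => z; rewrite linearP.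
  have dB := mixed_diff_differentiable v; have dB' := mixed_diff_differentiable
      v'.
  transitivity ('d (a *: (fun z => 'd (A \o P z) w0 v)) z0 u +
                'd (fun z => 'd (A \o P z) w0 v') z0 u).
    exact: (congr1 (@^~ u) (diffD (differentiableZ a dB) dB')).
  congr (_ + _); exact: (congr1 (@^~ u) (diffZ a dB)).
have -> : (fun v => 'd (fun z => 'd (A \o P z) w0 v) z0 u) =
          (fun v => 'd DA (P z0 w0, j v) (i u, 0)).
  by apply/funext => v; rewrite (@diff_val _ _ _ _ _ _ _ (is_diff_B v)).
move=> v.
have cj : continuous j.
  by rewrite -(@diff_val _ _ _ _ _ _ _ (diffr z0)); apply: diff_continuous;
    exact: (@ex_diff _ _ _ _ _ _ _ (diffr z0)).
have cDDA : {for ((P z0 w0, j v), (i u, 0)),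
    continuous (fun q : ((X * X) * (X * X))%type => 'd DA (q.1) (q.2))}.
  by apply: (smoothA 2).2.2; split=> //; split=> //; exact: nbhs_singleton.
have cpair : {for v, continuous (fun v => ((P z0 w0, j v), (i u, 0)) : ((X * X)
    * (X * X))%type)}.
  have c1 : {for v, continuous (fun v => (P z0 w0, j v) : (X * X)%type)}.
    by apply: continuous_pair; [exact: cvg_cst | exact: cj].
  exact: (continuous_pair c1 (cvg_cst _)).
exact: (continuous_comp cpair cDDA).
Qed.

Lemma mixed_diff_clinearl v : clinear ('d (fun z => 'd (A \o P z) w0 v) z0).
Proof. exact: (clinear_diff (mixed_diff_differentiable v)). Qed.

End mixed_derivative.

(** * Charts: local inversion, products, normed spaces *)

Section charts.
Context (R : realType) (M : topologicalType) (E : normedModType R) (c : chart M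
    E).
Context (x : M).
Hypotheses (chart_c : is_chart c) (dom_x : chart_dom c x).

Lemma chart_invK : chart_inv c (c x) = x.
Proof. by case: chart_c => _ _ cK _ _; rewrite cK// inE. Qed.

Lemma cvg_chart_inv : chart_inv c @ c x --> x.
Proof.
case: chart_c => _ _ _ _ cv.
have : {for c x, continuous (chart_inv c)} by apply: cv; rewrite inE; exists x.
by rewrite /prop_for /continuous_at chart_invK.
Qed.

(** The inverse chart is continuous at [c x] and the image of the domain is open, so close enough to
    [c x] the coordinates behave as a genuine chart with values in [V]. *)
Lemma near_chart_inv (V : set M) : nbhs x V ->
  \forall z \near c x,
    [/\ V (chart_inv c z), chart_dom c (chart_inv c z) & c (chart_inv c z) = z].
Proof.
case: (chart_c) => od oi cK _ _ Vx.
have nV : \forall z \near c x, V (chart_inv c z) by exact: cvg_chart_inv.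
have ni : \forall z \near c x, (c @` chart_dom c) z.
  by apply: open_nbhs_nbhs; split=> //; exists x.
apply: filterS2 nV ni => z Vz [y dy zE]; move: Vz.
by rewrite -zE cK ?inE //; split.
Qed.

Lemma nbhs_chart_image (V : set M) : nbhs x V ->
  nbhs (c x) (c @` (chart_dom c `&` V)).
Proof.
by move=> /near_chart_inv; apply: filterS => z [Vz dz <-]; exists (chart_inv c
    z).
Qed.

Lemma nbhs_chart_dom : nbhs x (chart_dom c).
Proof. by case: chart_c => od _ _ _ _; exact: open_nbhs_nbhs. Qed.

End charts.

Lemma open_setX (T U : topologicalType) (A : set T) (B : set U) :
  open A -> open B -> open (A `*` B).
Proof.
move=> oA oB; rewrite -[A `*` B]/(fst @^-1` A `&` snd @^-1` B).
by apply: openI; apply: open_comp => // p _; [exact: cvg_fst | exact: cvg_snd].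
Qed.

Lemma is_chart_prod (R : realType) (M N : topologicalType) (E F : normedModType
    R)
    (c : chart M E) (d : chart N F) :
  is_chart c -> is_chart d -> is_chart (prod_chart c d).
Proof.
move=> hc hd; have [oc oci cK cc cv] := hc; have [od odi dK dc dv] := hd.
have imE : prod_chart c d @` (chart_dom c `*` chart_dom d) =
    (c @` chart_dom c) `*` (d @` chart_dom d).
  apply/seteqP; split=> [_ [[x y] [/= dx dy] <-]|[z w] [/= [x dx <-] [y dy
      <-]]].
    by split; [exists x | exists y].
  by exists (x, y).
split.
- exact: open_setX.
- by rewrite [X in open X]imE; exact: open_setX.
- by move=> [x y]; rewrite inE => -[/= dx dy]; rewrite cK ?dK ?inE.
- move=> [x y]; rewrite inE => -[/= dx dy].
  have cx : {for x, continuous c} by apply: cc; rewrite inE.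
  have dy' : {for y, continuous d} by apply: dc; rewrite inE.
  apply: continuous_pair.
    by apply: (@continuous_comp _ _ _ fst c) => //; exact: cvg_fst.
  by apply: (@continuous_comp _ _ _ snd d) => //; exact: cvg_snd.
- move=> [z w]; rewrite inE [X in X _]imE => -[/= dz dw].
  have cx : {for z, continuous (chart_inv c)} by apply: cv; rewrite inE.
  have dy' : {for w, continuous (chart_inv d)} by apply: dv; rewrite inE.
  apply: continuous_pair.
    by apply: (@continuous_comp _ _ _ fst (chart_inv c)) => //; exact: cvg_fst.
  by apply: (@continuous_comp _ _ _ snd (chart_inv d)) => //; exact: cvg_snd.
Qed.

(** This condition holds for Lie groups and normed spaces and passes to products, so the calculus of
    tangent maps below covers [cotriv]. *)
Definition charts_ok (R : realType) (M : charted R) : Prop :=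
  forall x : M, is_chart (chart_at x) /\ chart_dom (chart_at x) x.

Lemma charts_ok_vec (R : realType) (E : normedModType R) : charts_ok (vec E).
Proof.
move=> x; split=> //; split=> //=.
- exact: openT.
- by rewrite image_id; exact: openT.
- by move=> y _; exact: cvg_id.
- by move=> y _; exact: cvg_id.
Qed.

Lemma charts_ok_prod (R : realType) (M N : charted R) :
  charts_ok M -> charts_ok N -> charts_ok (prodM M N).
Proof.
move=> okM okN [x y]; have [cx dx] := okM x; have [cy dy] := okN y.
by split; [exact: is_chart_prod | split].
Qed.

Lemma charts_ok_lie (R : realType) (G : lieGroup R) : charts_ok G.
Proof. by case: (lg_manifold G) => _. Qed.

(** * Calculus of tangent maps *)

(** Chart maps are total functions, so [local_expr] represents [f] only while [f] stays in the
    domain of the chart at [f x]. Continuity guarantees this near [x]. *)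
Definition mdiff (R : realType) (M N : charted R) (f : M -> N) (x : M) : Prop :=
  {for x, continuous f} /\ differentiable (local_expr f x) (chart_at x x).

Section tangent_maps.
Context (R : realType).
Implicit Types M N K : charted R.

Lemma mdiff_smooth M N (f : M -> N) (x : M) :
  charts_ok M -> charts_ok N -> smooth M N f -> mdiff f x.
Proof.
move=> okM okN [cf sf]; split; first exact: cf.
apply: (sf x 1).1; exists x => //; split; first exact: (okM x).2.
exact: (okN (f x)).2.
Qed.

(** Between the two local expressions stands the chart at [f x] followed by its inverse, which
    cancels where [f] takes values in its domain. *)
Lemma local_expr_comp M N K (f : M -> N) (g : N -> K) (x : M) :
  charts_ok M -> charts_ok N -> {for x, continuous f} ->
  \forall z \near chart_at x x,
    (local_expr g (f x) \o local_expr f x) z = local_expr (g \o f) x z.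
Proof.
move=> okM okN cf; have [cx dx] := okM x; have [cy dy] := okN (f x).
have nV : nbhs x (f @^-1` chart_dom (chart_at (f x))).
  exact: cf (nbhs_chart_dom cy dy).
apply: filterS (near_chart_inv cx dx nV) => z [Vz _ _].
rewrite /local_expr /=.
by case: cy => _ _ -> //; rewrite inE.
Qed.

Lemma is_diff_local_comp M N K (f : M -> N) (g : N -> K) (x : M) :
  charts_ok M -> charts_ok N -> mdiff f x -> mdiff g (f x) ->
  is_diff (chart_at x x) (local_expr (g \o f) x) (tmap _ _ g (f x) \o tmap _ _
      f x).
Proof.
move=> okM okN [cf df] [cg dg].
have fx : local_expr f x (chart_at x x) = chart_at (f x) (f x).
  by rewrite /local_expr /= chart_invK; [|exact: (okM x).1|exact: (okM x).2].
apply: is_diff_near (local_expr_comp _ okM okN cf) _.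
rewrite -fx in dg.
have := is_diff_comp (differentiableP df) (differentiableP dg).
by rewrite fx.
Qed.

Lemma mdiff_comp M N K (f : M -> N) (g : N -> K) (x : M) :
  charts_ok M -> charts_ok N -> mdiff f x -> mdiff g (f x) -> mdiff (g \o f) x.
Proof.
move=> okM okN mf mg; have [d _] := is_diff_local_comp okM okN mf mg.
by split=> //; case: mf mg => cf _ [cg _]; exact: continuous_comp.
Qed.

Lemma tmap_comp M N K (f : M -> N) (g : N -> K) (x : M) (v : tangent M x) :
  charts_ok M -> charts_ok N -> mdiff f x -> mdiff g (f x) ->
  tmap _ _ (g \o f) x v = tmap _ _ g (f x) (tmap _ _ f x v).
Proof.
move=> okM okN mf mg; have [_ dE] := is_diff_local_comp okM okN mf mg.
by rewrite /tmap dE.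
Qed.

Lemma tmap_clinear M N (f : M -> N) (x : M) : mdiff f x -> clinear (tmap _ _ f
    x).
Proof. by case=> _ df; exact: (clinear_diff df). Qed.

Lemma mdiff_pair M N K (f : M -> N) (g : M -> K) (x : M) :
  mdiff f x -> mdiff g x -> mdiff (fun y => (f y, g y) : prodM N K) x.
Proof.
move=> [cf df] [cg dg]; split; first exact: continuous_pair.
exact: (differentiable_pair df dg).
Qed.

Lemma tmap_pair M N K (f : M -> N) (g : M -> K) (x : M) (v : tangent M x) :
  mdiff f x -> mdiff g x ->
  tmap _ _ (fun y => (f y, g y) : prodM N K) x v = (tmap _ _ f x v, tmap _ _ g
      x v).
Proof. by move=> [_ df] [_ dg]; exact: (congr1 (@^~ v) (diff_pair df dg)). Qed.

Lemma is_diff_local_cst M N (y : N) (x : M) :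
  is_diff (chart_at x x) (local_expr (fun=> y) x : model M -> model N) (fun=>
      0).
Proof. exact: is_diff_cst. Qed.

Lemma mdiff_cst M N (y : N) (x : M) : mdiff (fun _ : M => y) x.
Proof.
by split; [exact: cvg_cst | have [] := is_diff_local_cst y x].
Qed.

Lemma tmap_cst M N (y : N) (x : M) (v : tangent M x) :
  tmap _ _ (fun _ : M => y) x v = 0.
Proof. by have [_ dE] := is_diff_local_cst y x; rewrite /tmap dE. Qed.

Lemma is_diff_local_id M (x : M) : charts_ok M ->
  is_diff (chart_at x x) (local_expr (@id M) x) id.
Proof.
move=> okM; have [cx dx] := okM x.
apply: is_diff_near (is_diff_id _).
apply: filterS (near_chart_inv cx dx (@filterT _ (nbhs x) _)) => z [_ _ /= zE].
by rewrite /local_expr /= zE.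
Qed.

Lemma mdiff_id M (x : M) : charts_ok M -> mdiff (@id M) x.
Proof.
by move=> okM; split; [exact: cvg_id | have [] := is_diff_local_id x okM].
Qed.

Lemma tmap_id M (x : M) (v : tangent M x) : charts_ok M -> tmap _ _ (@id M) x v
    = v.
Proof. by move=> okM; have [_ dE] := is_diff_local_id x okM; rewrite /tmap dE.
    Qed.

Lemma mdiff_fst M N (p : prodM M N) : charts_ok M -> charts_ok N ->
  mdiff (fst : prodM M N -> M) p.
Proof.
move=> okM okN; have [cp dp] := charts_ok_prod okM okN p.
split; first exact: cvg_fst.
apply: differentiable_near (@ex_diff _ _ _ _ _ _ _ (is_diff_fst _)).
apply: filterS (near_chart_inv cp dp (@filterT _ (nbhs p) _)) => z [_ _ /= zE].
by rewrite /local_expr /= -[in LHS]zE.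
Qed.

Lemma mdiff_snd M N (p : prodM M N) : charts_ok M -> charts_ok N ->
  mdiff (snd : prodM M N -> N) p.
Proof.
move=> okM okN; have [cp dp] := charts_ok_prod okM okN p.
split; first exact: cvg_snd.
apply: differentiable_near (@ex_diff _ _ _ _ _ _ _ (is_diff_snd _)).
apply: filterS (near_chart_inv cp dp (@filterT _ (nbhs p) _)) => z [_ _ /= zE].
by rewrite /local_expr /= -[in LHS]zE.
Qed.

Lemma mdiff_partial1 M N K (f : prodM M N -> K) (x : M) (y : N) :
  charts_ok M -> charts_ok N -> mdiff f (x, y) -> mdiff (fun x' => f (x', y)) x.
Proof.
move=> okM okN; apply: (mdiff_comp (f := fun x' : M => (x', y) : prodM M N)) =>
    //.
  exact: charts_ok_prod.
exact: (mdiff_pair (mdiff_id x okM) (mdiff_cst y x)).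
Qed.

Lemma mdiff_partial2 M N K (f : prodM M N -> K) (x : M) (y : N) :
  charts_ok M -> charts_ok N -> mdiff f (x, y) -> mdiff (fun y' => f (x, y')) y.
Proof.
move=> okM okN; apply: (mdiff_comp (f := fun y' : N => (x, y') : prodM M N)) =>
    //.
  exact: charts_ok_prod.
exact: (mdiff_pair (mdiff_cst x y) (mdiff_id y okN)).
Qed.

(** The base point [y] is kept apart from [f x] because in the uses [f x] is an expression such as
    [1 * g] or [g * g^-1] that is equal to [y] only by a group law. *)
Lemma tmap_cancel M N (f : M -> N) (f' : N -> M) (x : M) (y : N) (v : tangent M
    x) :
  charts_ok M -> charts_ok N -> cancel f f' -> f x = y -> mdiff f x -> mdiff f'
      y ->
  tmap _ _ f' y (tmap _ _ f x v) = v.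
Proof.
move=> okM okN fK fx mf mf'; rewrite -fx in mf' *.
rewrite -(tmap_comp v okM okN mf mf') (_ : f' \o f = id); last first.
  by apply/funext => z; exact: fK.
exact: (tmap_id v okM).
Qed.

(** Each partial map is [f] after a slice inclusion, whose tangent map sends [u] to [(u, 0)] or [v]
    to [(0, v)]; linearity adds the two. *)
Lemma tmap_prod M N K (f : prodM M N -> K) (x : M) (y : N)
    (u : tangent M x) (v : tangent N y) :
  charts_ok M -> charts_ok N -> mdiff f (x, y) ->
  tmap _ _ f (x, y) (u, v) =
  tmap _ _ (fun x' => f (x', y)) x u + tmap _ _ (fun y' => f (x, y')) y v.
Proof.
move=> okM okN mf.
pose il (x' : M) : prodM M N := (x', y).
pose ir (y' : N) : prodM M N := (x, y').
have dl : mdiff il x by exact: (mdiff_pair (mdiff_id x okM) (mdiff_cst y x)).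
have dr : mdiff ir y by exact: (mdiff_pair (mdiff_cst x y) (mdiff_id y okN)).
have -> : tmap _ _ (fun x' => f (x', y)) x u = tmap _ _ f (x, y) (u, 0).
  rewrite (tmap_comp (f := il) (g := f) u okM (charts_ok_prod okM okN) dl mf).
  rewrite (tmap_pair u (mdiff_id x okM) (mdiff_cst y x)).
  by rewrite tmap_id // tmap_cst.
have -> : tmap _ _ (fun y' => f (x, y')) y v = tmap _ _ f (x, y) (0, v).
  rewrite (tmap_comp (f := ir) (g := f) v okN (charts_ok_prod okM okN) dr mf).
  rewrite (tmap_pair v (mdiff_cst x y) (mdiff_id y okN)).
  by rewrite tmap_id // tmap_cst.
have -> : (u, v) = (u, 0) + (0, v) :> (model M * model N)%type.
  by congr pair; rewrite ?addr0 ?add0r.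
exact: linearD.
Qed.

End tangent_maps.

(** * Iterated tangent maps of a smooth map of two variables *)

Section mixed_tangent_maps.
Context (R : realType) (M N K : charted R) (f : prodM M N -> K) (x : M) (y : N).
Hypotheses (okM : charts_ok M) (okN : charts_ok N) (okK : charts_ok K).
Hypothesis smoothf : smooth (prodM M N) K f.

Let A := local_expr f (x, y).
Let S := @chart_at R (prodM M N) (x, y) @`
  (chart_dom (@chart_at R (prodM M N) (x, y)) `&` f @^-1` chart_dom (chart_at
      (f (x, y)))).

Let nbhsS : nbhs (chart_at x x, chart_at y y) S.
Proof.
have [cp dp] := charts_ok_prod okM okN (x, y); have [ck dk] := okK (f (x, y)).
apply: (nbhs_chart_image cp dp).
by apply: smoothf.1; exact: nbhs_chart_dom.
Qed.

Let smoothA : smooth_on S A.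
Proof. exact: smoothf.2. Qed.

Let P (z : model M) (w : model N) : (model M * model N)%type := (z, w).

Let diffP1 : is_diff (chart_at x x) (P^~ (chart_at y y)) (fun u => (u, 0)).
Proof. exact: is_diff_pair. Qed.

Let diffP2 z : is_diff (chart_at y y) (P z) (fun v => (0, v)).
Proof. exact: is_diff_pair. Qed.

Definition mixed_diff (u : model M) (v : model N) : model K :=
  'd (fun z => 'd (A \o P z) (chart_at y y) v) (chart_at x x) u.

Lemma mixed_diff_clinear2 u : clinear (mixed_diff u).
Proof. exact: (mixed_diff_clinearr smoothA nbhsS diffP1 diffP2). Qed.

Lemma mixed_diff_clinear1 v : clinear (mixed_diff ^~ v).
Proof. exact: (mixed_diff_clinearl smoothA nbhsS diffP1 diffP2). Qed.

Lemma differentiable_partial2 v :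
  differentiable (fun z => 'd (A \o P z) (chart_at y y) v) (chart_at x x).
Proof. exact: (mixed_diff_differentiable smoothA nbhsS diffP1 diffP2). Qed.

Let diffP1' w : is_diff (chart_at x x) (P^~ w) (fun u => (u, 0)).
Proof. exact: is_diff_pair. Qed.

Let diffP2' : is_diff (chart_at y y) (P (chart_at x x)) (fun v => (0, v)).
Proof. exact: is_diff_pair. Qed.

(* As [f x' y] is constant, the inner tangent maps are all read in the same chart
   of [K], which makes the iterated derivative a derivative in coordinates. *)
Lemma tmap_tmap2_clinear : (forall x', f (x', y) = f (x, y)) ->
  (forall u, clinear (fun v : model N =>
     tmap M (vec (model K)) (fun x' => tmap N K (fun y' => f (x', y')) y v) x
         u)) /\
  (forall v, clinear
     (tmap M (vec (model K)) (fun x' => tmap N K (fun y' => f (x', y')) y v)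
         x)).
Proof.
move=> fy.
have E v : (fun z => tmap N K (fun y' => f (chart_inv (chart_at x) z, y')) y v)
    =
    (fun z => 'd (A \o P z) (chart_at y y) v).
  by apply/funext => z; rewrite /tmap /A /local_expr fy.
pose D v := tmap M (vec (model K)) (fun x' => tmap N K (fun y' => f (x', y')) y
    v) x.
have DE v u : D v u = mixed_diff u v.
  exact: (congr1 (fun g => 'd g (chart_at x x) u) (E v)).
split=> [u|v].
  rewrite -[X in clinear X]/(fun v => D v u) (_ : (fun v => D v u) = mixed_diff
      u).
    exact: mixed_diff_clinear2.
  by apply/funext => v; exact: DE.
rewrite -[X in clinear X]/(D v) (_ : D v = mixed_diff^~ v).
  exact: mixed_diff_clinear1.
by apply/funext => u; exact: DE.
Qed.

(** The same argument with the order of differentiation exchanged: now [f (x, y')] is constant in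
    [y'], and the mixed derivative lemmas are applied to the family with its two parameters
    swapped. *)
Lemma tmap_tmap1_clinear : (forall y', f (x, y') = f (x, y)) ->
  (forall v, clinear (fun u : model M =>
     tmap N (vec (model K)) (fun y' => tmap M K (fun x' => f (x', y')) x u) y
         v)) /\
  (forall u, clinear
     (tmap N (vec (model K)) (fun y' => tmap M K (fun x' => f (x', y')) x u)
         y)).
Proof.
move=> fx.
have E u : (fun w => tmap M K (fun x' => f (x', chart_inv (chart_at y) w)) x u)
    =
    (fun w => 'd (A \o P^~ w) (chart_at x x) u).
  by apply/funext => w; rewrite /tmap /A /local_expr fx.
pose D u := tmap N (vec (model K)) (fun y' => tmap M K (fun x' => f (x', y')) x
    u) y.
pose D' u v := 'd (fun w => 'd (A \o P^~ w) (chart_at x x) u) (chart_at y y) v.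
have DE u v : D u v = D' u v.
  exact: (congr1 (fun g => 'd g (chart_at y y) v) (E u)).
split=> [v|u].
  rewrite -[X in clinear X]/(fun u => D u v) (_ : (fun u => D u v) = D'^~ v).
    exact: (mixed_diff_clinearr (P := fun w z => P z w) smoothA nbhsS diffP2'
        diffP1' v).
  by apply/funext => u; exact: DE.
rewrite -[X in clinear X]/(D u) (_ : D u = D' u).
  exact: (mixed_diff_clinearl (P := fun w z => P z w) smoothA nbhsS diffP2'
      diffP1' u).
by apply/funext => v; exact: DE.
Qed.

End mixed_tangent_maps.

(** * The Lie bracket as a second derivative of the multiplication *)

Section lie_bracket.
Context (R : realType) (G : lieGroup R).
Local Notation LG := (lie_algebra G).

Let mul (p : prodM G G) : lg_charted G := (p.1 * p.2)%g.
Let okG : charts_ok G := @charts_ok_lie R G.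
Let okGG := charts_ok_prod okG okG.

Lemma mdiff_mul (p : prodM G G) : mdiff mul p.
Proof. exact: (mdiff_smooth p okGG okG (@lg_smooth_mul _ G)). Qed.

Lemma mdiff_mull (g x : G) : mdiff (M := G) (N := G) (fun k : G => (g * k)%g) x.
Proof.
have dp := mdiff_pair (mdiff_cst (M := G) (N := G) g x) (mdiff_id (M := G) x
    okG).
exact: (mdiff_comp okG okGG dp (mdiff_mul (g, x))).
Qed.

Lemma mdiff_mulr (g x : G) : mdiff (M := G) (N := G) (fun k : G => (k * g)%g) x.
Proof.
have dp := mdiff_pair (mdiff_id (M := G) x okG) (mdiff_cst (M := G) (N := G) g
    x).
exact: (mdiff_comp okG okGG dp (mdiff_mul (x, g))).
Qed.

Let c1 := @chart_at R G 1%g.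
Let z0 := c1 1%g.
Let B (xi : LG) (z : model G) : model G :=
  'd (local_expr mul (1%g, 1%g) \o pair z) z0 xi.

(* Changing chart at [y] cancels against the chart in which the translated vector
   is computed, so the left invariant field is a partial derivative of the
   multiplication read in the charts at 1. *)
Lemma vf_expr_left_invariant (xi : LG) :
  \forall z \near z0, B xi z = vf_expr (M := G) (left_invariant xi) 1%g z.
Proof.
have [hc1 d1] := okG 1%g.
apply: filterS (near_chart_inv hc1 d1 (@filterT _ (nbhs (1%g : G)) _)) => z [_
    dz cz].
rewrite /vf_expr; set y := chart_inv _ z.
have [hcy dy] := okG y.
have [cy dl] := mdiff_mull y 1%g.
have yE : (y * 1)%g = y by rewrite mulg1.
(* The local expression uses the chart at [y * 1], while the field at [y] is read in the chart at
   [y]; [mulg1] identifies them. *)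
have lE : local_expr (M := G) (N := G) (fun k : G => (y * k)%g) 1%g =
    chart_at y \o (fun k : G => (y * k)%g : lg_charted G) \o chart_inv c1.
  by rewrite /local_expr yE.
rewrite lE in dl.
have [_ _ overlap] := lg_manifold G.
have dov : differentiable (c1 \o chart_inv (chart_at y)) (chart_at y y).
  by apply: (overlap y 1%g 1).1; exists y.
rewrite /left_invariant /tmap lE.
set l := (X in 'd X z0 xi) in dl *.
have lz : l z0 = chart_at y y by rewrite /l /= /z0 chart_invK ?mulg1.
rewrite -lz in dov *.
rewrite -[RHS]/(('d (c1 \o chart_inv (chart_at y)) (l z0) \o 'd l z0) xi).
rewrite -(diff_comp dl dov) /B.
have nd : nbhs (1%g : G) ((fun k : G => (y * k)%g : G) @^-1` chart_dom
    (chart_at y)).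
  by apply: cy; rewrite yE; exact: nbhs_chart_dom.
have lE' : \forall w \near z0, (c1 \o chart_inv (chart_at y) \o l) w =
    (local_expr mul (1%g, 1%g) \o pair z) w.
  apply: filterS (near_chart_inv hc1 d1 nd) => w [yw _ _].
  rewrite /l /local_expr /mul /= mulg1.
  by case: hcy => _ _ -> //; rewrite inE.
exact: (congr1 (@^~ xi) (diff_near lE' (differentiable_comp dl dov))).
Qed.

Let mB u v := mixed_diff mul 1%g 1%g u v.

(** A differential depends only on the germ, so each left invariant field may be replaced by the
    corresponding [B], whose differential at [z0] is a mixed second derivative of the
    multiplication. *)
Lemma lie_bracketE (xi1 xi2 : LG) :
  lie_bracket xi1 xi2 = mB (B xi1 z0) xi2 - mB (B xi2 z0) xi1.
Proof.
have V xi : 'd (vf_expr (M := G) (left_invariant xi) 1%g) z0 = 'd (B xi) z0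
    :> (model G -> model G).
  apply: diff_near (vf_expr_left_invariant xi) _.
  have d := differentiable_partial2 (f := mul) (1%g : G) (1%g : G) okG okG okG
      (@lg_smooth_mul _ G) xi.
  exact: d.
rewrite /lie_bracket /vf_bracket !V.
by rewrite -!(nbhs_singleton (vf_expr_left_invariant _)).
Qed.

Lemma lie_bracketN (x y : LG) : lie_bracket x y = - lie_bracket y x.
Proof. by rewrite /lie_bracket /vf_bracket opprB. Qed.

Lemma lie_bracket_clinear2 (x : LG) : clinear (lie_bracket x).
Proof.
have -> : lie_bracket x = (fun y => mB (B x z0) y - mB (B y z0) x).
  by apply/funext => y; rewrite lie_bracketE.
have mB2 u : clinear (mB u).
  exact: (mixed_diff_clinear2 (f := mul) (1%g : G) (1%g : G) okG okG okG
      (@lg_smooth_mul _ G) u).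
have mB1 v : clinear (mB^~ v).
  exact: (mixed_diff_clinear1 (f := mul) (1%g : G) (1%g : G) okG okG okG
      (@lg_smooth_mul _ G) v).
apply: clinearD; first exact: mB2.
(* [B y z0] is the differential at [z0] of a partial map of the multiplication, applied to [y],
   hence continuous linear in [y]. *)
apply: clinearN; apply: (clinear_comp (f := fun y => B y z0) (g := mB^~ x)).
  apply: clinear_diff.
  have d : differentiable (local_expr mul (1%g, 1%g)) (z0, z0).
    by have [] := mdiff_mul (1%g, 1%g).
  have dp : is_diff z0 (pair z0) (fun v : model G => (0 : model G, v)).
    exact: is_diff_pair.
  exact: (differentiable_comp (@ex_diff _ _ _ _ _ _ _ dp) d).
exact: mB1.
Qed.

End lie_bracket.

(** * Infinitesimal actions, matched pair bracket and coadjoint action *)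

Section matched_pair.
Context (R : realType) (G H : lieGroup R) (mp : matchedPair G H).
Local Notation LG := (lie_algebra G).
Local Notation LH := (lie_algebra H).

Let okG : charts_ok G := @charts_ok_lie R G.
Let okH : charts_ok H := @charts_ok_lie R H.
Let okHG := charts_ok_prod okH okG.
Let okGH : charts_ok (mpM G H) := charts_ok_prod okG okH.

Lemma mdiff_lact_l (g : G) (x : H) : mdiff (M := H) (N := G) (fun h => lact mp
    h g) x.
Proof.
have dp := mdiff_pair (mdiff_id (M := H) x okH) (mdiff_cst (M := H) (N := G) g
    x).
exact: (mdiff_comp okH okHG dp (mdiff_smooth (M := prodM H G) (x, g) okHG okG
    (lact_smooth mp))).
Qed.

Lemma mdiff_ract_l (g : G) (x : H) : mdiff (M := H) (N := H) (fun h => ract mp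
    h g) x.
Proof.
have dp := mdiff_pair (mdiff_id (M := H) x okH) (mdiff_cst (M := H) (N := G) g
    x).
exact: (mdiff_comp okH okHG dp (mdiff_smooth (M := prodM H G) (x, g) okHG okH
    (ract_smooth mp))).
Qed.

(** The action is a mixed second derivative of [lact] at the units, taken first in [G]; the axiom
    [lact_one] makes all inner tangent maps end at the unit. *)
Lemma lact_vv_clinear2 (eta : LH) : clinear (lact_vv mp eta).
Proof.
have h1 (x' : H) : lact mp x' 1%g = lact mp 1%g 1%g by rewrite !lact_one.
have cl := (tmap_tmap2_clinear (M := H) (N := G) (x := 1%g) (y := 1%g)
  (K := G) (f := fun p => lact mp p.1 p.2) okH okG okG (lact_smooth mp) h1).1
      eta.
exact: cl.
Qed.

Lemma lact_vv_clinear1 (xi : LG) : clinear (fun eta => lact_vv mp eta xi).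
Proof.
have h1 (x' : H) : lact mp x' 1%g = lact mp 1%g 1%g by rewrite !lact_one.
have cl := (tmap_tmap2_clinear (M := H) (N := G) (x := 1%g) (y := 1%g)
  (K := G) (f := fun p => lact mp p.1 p.2) okH okG okG (lact_smooth mp) h1).2
      xi.
exact: cl.
Qed.

(** Here the inner derivative is taken in [H], and [ract_one] provides the fixed end point. *)
Lemma ract_vv_clinear2 (eta : LH) : clinear (ract_vv mp eta).
Proof.
have h1 (y' : G) : ract mp 1%g y' = ract mp 1%g 1%g by rewrite !ract_one.
have cl := (tmap_tmap1_clinear (M := H) (N := G) (x := 1%g) (y := 1%g)
  (K := H) (f := fun p => ract mp p.1 p.2) okH okG okH (ract_smooth mp) h1).2
      eta.
exact: cl.
Qed.

Lemma ract_vv_clinear1 (xi : LG) : clinear (fun eta => ract_vv mp eta xi).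
Proof.
have h1 (y' : G) : ract mp 1%g y' = ract mp 1%g 1%g by rewrite !ract_one.
have cl := (tmap_tmap1_clinear (M := H) (N := G) (x := 1%g) (y := 1%g)
  (K := H) (f := fun p => ract mp p.1 p.2) okH okG okH (ract_smooth mp) h1).1
      xi.
exact: cl.
Qed.

Lemma mp_bracketN (x y : (LG * LH)%type) : mp_bracket mp x y = - mp_bracket mp
    y x.
Proof.
rewrite /mp_bracket; congr pair => /=.
  by rewrite (lie_bracketN y.1) !opprD !opprK addrAC.
by rewrite (lie_bracketN y.2) !opprD !opprK addrAC.
Qed.

Lemma mp_bracket_clinear2 (x : (LG * LH)%type) : clinear (mp_bracket mp x).
Proof.
pose E : normedModType R := (LG * LH)%type.
have f1 : clinear (fst : E -> LG) := clinear_fst _ _.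
have f2 : clinear (snd : E -> LH) := clinear_snd _ _.
apply: (clinear_pair (E := E)).
  apply: clinearD; first apply: clinearD.
  - exact: (clinear_comp f1 (lie_bracket_clinear2 x.1)).
  - exact: (clinear_comp f1 (lact_vv_clinear2 x.2)).
  - apply: clinearN; exact: (clinear_comp f2 (lact_vv_clinear1 x.1)).
apply: clinearD; first apply: clinearD.
- exact: (clinear_comp f2 (lie_bracket_clinear2 x.2)).
- exact: (clinear_comp f1 (ract_vv_clinear2 x.2)).
- apply: clinearN; exact: (clinear_comp f2 (ract_vv_clinear1 x.1)).
Qed.

Lemma mp_bracket_linear1 (y : (LG * LH)%type) : linear (mp_bracket mp ^~ y).
Proof.
move=> a x x'; rewrite 3!(mp_bracketN _ y) (mp_bracket_clinear2 y).1.
by rewrite opprD scalerN.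
Qed.

Lemma pairing_clinear (m : (dual LG * dual LH)%type) :
  clinear (fun x : (LG * LH)%type => pairing m x : R^o).
Proof.
apply: clinearD.
  exact: (clinear_comp (clinear_fst _ _) (clinear_dual m.1)).
exact: (clinear_comp (clinear_snd _ _) (clinear_dual m.2)).
Qed.

Lemma pairing_linear1 (x : (LG * LH)%type) :
  linear (fun m : (dual LG * dual LH)%type => pairing m x : R^o).
Proof. by move=> a m m'; rewrite /pairing scalerDr addrACA. Qed.

Lemma pairing_inj (m m' : (dual LG * dual LH)%type) :
  (forall x, pairing m x = pairing m' x) -> m = m'.
Proof.
case: m m' => [m1 m2] [n1 n2] mm'; congr pair; apply: dual_ext => x.
  have := mm' (x, 0); rewrite /pairing /= !(clinear0 (clinear_dual _)) !addr0.
  exact.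
have := mm' (0, x); rewrite /pairing /= !(clinear0 (clinear_dual _)) !add0r.
exact.
Qed.

(** The dual of the product is the product of the duals: restrict [f] to the two summands and
    recombine. *)
Lemma pairing_to_dual (f : (LG * LH)%type -> R^o) : clinear f ->
  exists m : (dual LG * dual LH)%type, forall y, pairing m y = f y.
Proof.
move=> cf.
have c1 : clinear (fun y : LG => f (y, 0)).
  apply: (clinear_comp (f := fun y : LG => (y, 0 : LH)) _ cf).
  by apply: clinear_pair; [exact: clinear_id | split=> [a u v|v]; [rewrite
      scaler0 addr0 | exact: cvg_cst]].
have c2 : clinear (fun y : LH => f (0, y)).
  apply: (clinear_comp (f := fun y : LH => (0 : LG, y)) _ cf).
  by apply: clinear_pair; [split=> [a u v|v]; [rewrite scaler0 addr0 | exact: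
      cvg_cst] | exact: clinear_id].
exists (to_dual (fun y : LG => f (y, 0)), to_dual (fun y : LH => f (0, y))) =>
    y.
rewrite /pairing /= (to_dualE c1) (to_dualE c2).
have := cf.1 1 (y.1, 0) (0, y.2).
rewrite !scale1r => <-; congr f.
by case: y => y1 y2; congr pair; rewrite /= ?addr0 ?add0r.
Qed.

(** Continuity of the bracket in its second argument makes the prescribed functional an element of
    the dual, so the choice in [mp_coad] has a witness. *)
Lemma pairing_mp_coad (x y : (LG * LH)%type) (m : (dual LG * dual LH)%type) :
  pairing (mp_coad mp x m) y = - pairing m (mp_bracket mp x y).
Proof.
have cf := clinearN (clinear_comp (mp_bracket_clinear2 x) (pairing_clinear m)).
have [m' m'E] := pairing_to_dual cf.
have := @xgetPex _ (0 : (dual LG * dual LH)%type)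
  [set m' | forall y, pairing m' y = - pairing m (mp_bracket mp x y)].
by apply; exists m'.
Qed.

End matched_pair.

(** * Right translation and existence of the canonical form *)

Section canonical_form.
Context (R : realType) (G H : lieGroup R) (mp : matchedPair G H).
Local Notation LG := (lie_algebra G).
Local Notation LH := (lie_algebra H).

Let okG : charts_ok G := @charts_ok_lie R G.
Let okH : charts_ok H := @charts_ok_lie R H.
Let okGH : charts_ok (mpM G H) := charts_ok_prod okG okH.

(** The values are typed in the model space, shared by all tangent spaces, so that they count as
    vectors at [k] and not at the product of the unit with [k]. *)
Definition mp_translation (k : mpM G H) (x : (LG * LH)%type) :
    (model G * model H)%type :=
  tmap (mpM G H) (mpM G H) (fun k' => mp_mul mp k' k) (mp_one G H) x.

(** The [H] component of the product [k' k] involves only the [H] part of [k'], which makes the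
    tangent map triangular. The [G] component splits at the unit by [lact1] and [mul1g]. *)
Lemma mp_translationE (g : G) (h : H) (xi : LG) (eta : LH) :
  mp_translation (g, h) (xi, eta) =
  (tmap G G (fun k => (k * g)%g) 1%g xi + lact_vg mp eta g,
   tmap H H (fun k => (k * h)%g) 1%g (ract_vg mp eta g)).
Proof.
pose f1 (k : mpM G H) : lg_charted G := (k.1 * lact mp k.2 g)%g.
pose f2 (k : mpM G H) : lg_charted H := (ract mp k.2 g * h)%g.
pose o : mpM G H := mp_one G H.
have d1 : mdiff f1 o.
  have dl : mdiff (M := mpM G H) (N := G) (fun k => lact mp k.2 g) o.
    exact: (mdiff_comp (M := mpM G H) (N := H) (K := G) (f := snd)
      (g := fun h' => lact mp h' g) okGH okH (mdiff_snd o okG okH)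
          (mdiff_lact_l mp g _)).
  have dp := mdiff_pair (mdiff_fst o okG okH) dl.
  exact: (mdiff_comp okGH (charts_ok_prod okG okG) dp (mdiff_mul _)).
have dr : mdiff (M := H) (N := H) (fun k => (ract mp k g * h)%g) 1%g.
  exact: (mdiff_comp (M := H) (N := H) (K := H) okH okH (mdiff_ract_l mp g _)
    (mdiff_mulr h _)).
have d2 : mdiff f2 o.
  exact: (mdiff_comp (M := mpM G H) (N := H) (K := H) (f := snd)
    okGH okH (mdiff_snd o okG okH) dr).
rewrite /mp_translation.
rewrite -[LHS]/(tmap (mpM G H) (prodM G H) (fun k => (f1 k, f2 k)) o (xi, eta)).
rewrite (tmap_pair _ d1 d2); congr pair.
  have E1 : tmap G G (fun x' => f1 (x', 1%g)) 1%g xi =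
      tmap G G (fun k => (k * g)%g) 1%g xi by rewrite /f1 /= lact1.
  have E2 : tmap H G (fun y' => f1 (1%g, y')) 1%g eta = lact_vg mp eta g.
    rewrite /lact_vg
      (_ : (fun y' => f1 (1%g, y')) = (fun y' : H => lact mp y' g)).
      by [].
    by apply/funext => y'; rewrite /f1 /= mul1g.
  have E := tmap_prod (M := G) (N := H) (f := f1) xi eta okG okH d1.
  exact: (etrans E (congr2 +%R E1 E2)).
rewrite (tmap_prod (M := G) (N := H) (f := f2) xi eta okG okH d2).
rewrite [X in X + _](tmap_cst (M := G) (N := H) (ract mp 1%g g * h)%g) add0r.
rewrite (tmap_comp (M := H) (N := H) (K := H) (f := fun k => ract mp k g)
  (g := fun k => (k * h)%g) eta okH okH (mdiff_ract_l mp g _) (mdiff_mulr h _)).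
by rewrite ract_one.
Qed.

Lemma mp_translation_bij (k : mpM G H) : exists T : model G * model H -> (LG *
    LH)%type,
  [/\ linear T, cancel (mp_translation k) T & cancel T (mp_translation k)].
Proof.
case: k => g h.
pose Rg := tmap G G (fun k => (k * g)%g) 1%g.
pose Rg' := tmap G G (fun k => (k * g^-1)%g) g.
pose Rh := tmap H H (fun k => (k * h)%g) 1%g.
pose Rh' := tmap H H (fun k => (k * h^-1)%g) h.
pose Sg := tmap H H (fun k => ract mp k g) 1%g.
pose Sg' := tmap H H (fun k => ract mp k g^-1%g) 1%g.
have RgK : cancel Rg Rg'.
  move=> v; apply: (tmap_cancel (M := G) (N := G) v okG okG _ _ (mdiff_mulr g
      _) (mdiff_mulr _ _)).
    by move=> k; rewrite mulgK.
  by rewrite mul1g.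
have Rg'K : cancel Rg' Rg.
  move=> v; apply: (tmap_cancel (M := G) (N := G) v okG okG _ _ (mdiff_mulr _
      _) (mdiff_mulr g _)).
    by move=> k; rewrite mulgVK.
  by rewrite mulgV.
have RhK : cancel Rh Rh'.
  move=> v; apply: (tmap_cancel (M := H) (N := H) v okH okH _ _ (mdiff_mulr h
      _) (mdiff_mulr _ _)).
    by move=> k; rewrite mulgK.
  by rewrite mul1g.
have Rh'K : cancel Rh' Rh.
  move=> v; apply: (tmap_cancel (M := H) (N := H) v okH okH _ _ (mdiff_mulr _
      _) (mdiff_mulr h _)).
    by move=> k; rewrite mulgVK.
  by rewrite mulgV.
have SgK : cancel Sg Sg'.
  move=> v; apply: (tmap_cancel (M := H) (N := H) v okH okH _ _ (mdiff_ract_l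
      mp g _) (mdiff_ract_l mp _ _)).
    by move=> k; rewrite -ractM mulgV ract1.
  by rewrite ract_one.
have Sg'K : cancel Sg' Sg.
  move=> v; apply: (tmap_cancel (M := H) (N := H) v okH okH _ _ (mdiff_ract_l
      mp _ _) (mdiff_ract_l mp g _)).
    by move=> k; rewrite -ractM mulVg ract1.
  by rewrite ract_one.
pose L eta := lact_vg mp eta g.
have cRg' : linear Rg' by exact: (tmap_clinear (mdiff_mulr g^-1%g g)).1.
have cRh' : linear Rh' by exact: (tmap_clinear (mdiff_mulr h^-1%g h)).1.
have cSg' : linear Sg' by exact: (tmap_clinear (mdiff_ract_l mp g^-1%g 1%g)).1.
have cL : linear L by exact: (tmap_clinear (mdiff_lact_l mp g 1%g)).1.
(* Back substitution in the triangular system: the second component gives [eta], whose contribution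
   [L eta] is then removed from the first. *)
exists (fun ab => (Rg' (ab.1 - L (Sg' (Rh' ab.2))), Sg' (Rh' ab.2))); split.
- move=> a [u1 u2] [v1 v2]; congr pair => /=; last by rewrite cRh' cSg'.
  by rewrite cRh' cSg' cL -cRg' scalerBr opprD addrACA.
- move=> [xi eta]; rewrite mp_translationE /=.
  rewrite -/(Rg xi) -[ract_vg mp eta g]/(Sg eta) -/(Rh (Sg eta)) RhK SgK.
  by rewrite -/(L eta) addrK RgK.
- move=> [a b] /=; rewrite mp_translationE.
  rewrite -/(Rg _) -[ract_vg mp _ g]/(Sg _) -/(Rh _) Sg'K Rh'K Rg'K.
  by rewrite -/(L _) subrK.
Qed.

Lemma right_invariantE (m : (dual LG * dual LH)%type) (x : (LG * LH)%type)
    (p : cotriv G H) :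
  right_invariant mp m x p = (m + mp_coad mp x p.1, mp_translation p.2 x).
Proof. by []. Qed.

(** The group part of [v] fixes the Lie algebra element; the momentum is what remains after
    subtracting its coadjoint term. *)
Lemma right_invariant_surj (p : cotriv G H) (v : tangent (cotriv G H) p) :
  exists m x, v = right_invariant mp m x p.
Proof.
have [T [_ _ TK]] := mp_translation_bij p.2.
exists (v.1 - mp_coad mp (T v.2) p.1), (T v.2).
rewrite right_invariantE TK subrK.
by case: v.
Qed.

Lemma canonical_form_exists :
  exists Om : forall p : cotriv G H, tangent (cotriv G H) p -> tangent (cotriv
      G H) p -> R,
    is_canonical_form mp Om.
Proof.
pose T (k : mpM G H) := sval (cid (mp_translation_bij k)).
have TP k : [/\ linear (T k), cancel (mp_translation k) (T k) &
    cancel (T k) (mp_translation k)] by exact: svalP (cid (mp_translation_bij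
        k)).
(* On right invariant vectors the coadjoint terms hidden in [w.1] and [v.1] each contribute the
   bracket term once. The last summand removes one of the two copies, whence its minus sign. *)
exists (fun p v w => pairing w.1 (T p.2 v.2) - pairing v.1 (T p.2 w.2)
  - pairing p.1 (mp_bracket mp (T p.2 v.2) (T p.2 w.2))).
have distr (a x y z x' y' z' : R) : (a * x + x') - (a * y + y') - (a * z + z') =
    a * (x - y - z) + (x' - y' - z') by ring.
split.
- move=> p v a w w'; have [lT _ _] := TP p.2.
  have eT : T p.2 (a *: w + w').2 = a *: T p.2 w.2 + T p.2 w'.2 by exact: lT.
  rewrite /= [T _ (_ + _)]eT (mp_bracket_clinear2 mp _).1 !(pairing_clinear
      _).1.
  by rewrite (pairing_linear1 _ a w.1 w'.1); exact: distr.
- move=> p v a w w'; have [lT _ _] := TP p.2.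
  have eT : T p.2 (a *: w + w').2 = a *: T p.2 w.2 + T p.2 w'.2 by exact: lT.
  rewrite /= [T _ (_ + _)]eT (mp_bracket_linear1 mp _ a) !(pairing_clinear _).1.
  by rewrite (pairing_linear1 _ a w.1 w'.1); exact: distr.
- move=> p v.
  have -> : mp_bracket mp (T p.2 v.2) (T p.2 v.2) = 0.
    by rewrite /mp_bracket /lie_bracket /vf_bracket !subrr !add0r !subrr.
  by rewrite subrr (clinear0 (pairing_clinear _)) subrr.
- move=> m1 x1 m2 x2 p; rewrite !right_invariantE /=; have [_ TK _] := TP p.2.
  rewrite !TK.
  have pD (m m' : (dual LG * dual LH)%type) y : pairing (m + m') y = pairing m
      y + pairing m' y.
    by have := pairing_linear1 y 1 m m'; rewrite !scale1r.
  rewrite !pD !pairing_mp_coad (mp_bracketN mp x2) (clinear_opp _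
      (pairing_clinear _)).
  ring.
Qed.

End canonical_form.

(** * Gradients and Hamiltonian vector fields *)

Section hamiltonian_fields.
Context (R : realType).

(* Reflexivity at the zero functional: only [0] is annihilated by the dual. *)
Lemma reflexive_separated (E : normedModType R) (x y : E) :
  reflexive_space E -> (forall f : dual E, f x = f y) -> x = y.
Proof.
move=> refl fxy; have [z [_ zu]] := refl 0.
apply/eqP; rewrite -subr_eq0; apply/eqP.
rewrite -(zu 0) => [|f]; last by rewrite (clinear0 (clinear_dual f)).
apply/esym/zu => f.
by rewrite (clinear_add _ _ (clinear_dual f)) (clinear_opp _ (clinear_dual f))
    fxy subrr.
Qed.

(** The differential of [f] at [m] is a continuous functional on the dual, that is, an element of
    the bidual, which reflexivity represents by a vector. *)
Lemma dual_gradientE (E : normedModType R) (f : dual E -> R^o) (m m' : dual E) :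
  reflexive_space E -> mdiff (M := vec (dual E)) (N := vec R^o) f m ->
  tmap (vec (dual E)) (vec R^o) f m m' = m' (dual_gradient f m).
Proof.
move=> refl mf; have cl := tmap_clinear mf.
have [x [xE _]] := refl (to_dual (tmap (vec (dual E)) (vec R^o) f m)).
apply: (@xgetPex _ 0
  [set x | forall m' : dual E, tmap (vec (dual E)) (vec R^o) f m m' = m' x]).
by exists x => n; rewrite -xE (to_dualE cl).
Qed.

Lemma covectorE (M : charted R) (f : M -> R^o) (x : M) (v : tangent M x) :
  mdiff (N := vec R^o) f x -> covector M f x v = tmap M (vec R^o) f x v.
Proof. by move=> mf; rewrite /covector (to_dualE (tmap_clinear mf)). Qed.

Context (G H : lieGroup R) (mp : matchedPair G H).
Local Notation LG := (lie_algebra G).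
Local Notation LH := (lie_algebra H).

Let okG : charts_ok G := @charts_ok_lie R G.
Let okH : charts_ok H := @charts_ok_lie R H.
Let okGH : charts_ok (mpM G H) := charts_ok_prod okG okH.

Lemma Omega_canonical : is_canonical_form mp (@Omega _ _ _ mp).
Proof.
have := @xgetPex _ (fun _ _ _ => 0) (is_canonical_form mp).
by apply; exact: canonical_form_exists.
Qed.

Lemma Omega_right_invariant m1 x1 m2 x2 (p : cotriv G H) :
  Omega mp (right_invariant mp m1 x1 p) (right_invariant mp m2 x2 p) =
  pairing m2 x1 - pairing m1 x2 + pairing p.1 (mp_bracket mp x1 x2).
Proof. by case: Omega_canonical => _ _ _; exact. Qed.

Hypotheses (reflG : reflexive_space LG) (reflH : reflexive_space LH).

(** The proposed vector solves the defining equation, which is checked on right invariant vectors.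
    Since the field is chosen among all solutions, nondegeneracy of the form is then used to show
    that it equals this one. *)
Lemma hamiltonian_field_right_invariant (F : cotriv G H -> R^o) (p : cotriv G H)
    (m : (dual LG * dual LH)%type) (x : (LG * LH)%type) :
  mdiff (N := vec R^o) F p ->
  (forall m', tmap (cotriv G H) (vec R^o) F p (m', 0) = pairing m' x) ->
  (forall y, tmap (cotriv G H) (vec R^o) F p (0, mp_translation mp p.2 y) =
     - pairing m y) ->
  hamiltonian_field mp F p = right_invariant mp m x p.
Proof.
move=> mF Fm Fk; have cF := tmap_clinear mF.
have VE w : Omega mp (right_invariant mp m x p) w = tmap (cotriv G H) (vec R^o)
    F p w.
  have [m2 [x2 ->]] := right_invariant_surj mp w.
  rewrite Omega_right_invariant right_invariantE.
  have -> : (m2 + mp_coad mp x2 p.1, mp_translation mp p.2 x2) =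
      (m2 + mp_coad mp x2 p.1, 0) + (0, mp_translation mp p.2 x2)
      :> tangent (cotriv G H) p.
    by congr pair; rewrite /= ?addr0 ?add0r.
  rewrite (clinear_add _ _ cF) Fm Fk.
  have -> : pairing (m2 + mp_coad mp x2 p.1) x = pairing m2 x + pairing
      (mp_coad mp x2 p.1) x.
    by have := pairing_linear1 x 1 m2 (mp_coad mp x2 p.1); rewrite !scale1r.
  (* The coadjoint part of the test vector, paired with [x], yields exactly the bracket term of the
     form. *)
  rewrite pairing_mp_coad (mp_bracketN mp x2) (clinear_opp _ (pairing_clinear
      _)) opprK.
  by rewrite addrAC.
have VE' w : Omega mp (hamiltonian_field mp F p) w = tmap (cotriv G H) (vec
    R^o) F p w.
  move: w; apply: (@xgetPex _ 0
    [set v | forall w, Omega mp v w = tmap (cotriv G H) (vec R^o) F p w]).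
  by exists (right_invariant mp m x p).
have [m' [x' V'E]] := right_invariant_surj mp (hamiltonian_field mp F p).
rewrite V'E in VE' *.
have key m2 x2 : pairing m2 x' - pairing m' x2 + pairing p.1 (mp_bracket mp x'
    x2) =
    pairing m2 x - pairing m x2 + pairing p.1 (mp_bracket mp x x2).
  by rewrite -!Omega_right_invariant VE VE'.
(* Test vectors with zero Lie algebra part isolate [x']; functionals separate points by
   reflexivity. *)
have xx' : x' = x.
  have key0 m2 : pairing m2 x' = pairing m2 x.
    have := key m2 0.
    rewrite !(clinear0 (mp_bracket_clinear2 mp _)) !(clinear0 (pairing_clinear
        _)).
    by rewrite !subr0 !addr0.
  case: x x' key0 {Fm VE V'E VE' key} => [x1 x2] [x1' x2'] key0; congr pair.
    apply: (reflexive_separated reflG) => f.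
    by have := key0 (f, 0); rewrite /pairing /= !addr0.
  apply: (reflexive_separated reflH) => f.
  by have := key0 (0, f); rewrite /pairing /= !add0r.
(* With the Lie algebra parts equal, test vectors of zero momentum determine [m']. *)
rewrite xx'; congr (right_invariant mp _ x p); apply: pairing_inj => y.
have := key 0 y; rewrite xx' => /addIr /addrI; exact: oppr_inj.
Qed.

(** * The Hamiltonian field and the bracket in partial derivatives *)

Context (F : cotriv G H -> R^o) (mu : dual LG) (nu : dual LH) (g : G) (h : H).
Hypothesis smoothF : smooth (cotriv G H) (vec R^o) F.

Let p : cotriv G H := ((mu, nu), (g, h)).
Let F_mu := d_mu F mu nu g h.
Let F_nu := d_nu F mu nu g h.
Let F_g := d_g F mu nu g h.
Let F_h := d_h F mu nu g h.

Let okV1 : charts_ok (vec (dual LG)) := charts_ok_vec (E := dual LG).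
Let okV2 : charts_ok (vec (dual LH)) := charts_ok_vec (E := dual LH).
Let okV := charts_ok_prod okV1 okV2.

Let mF : mdiff (N := vec R^o) F p.
Proof.
exact: (mdiff_smooth p (charts_ok_prod okV okGH) (charts_ok_vec (E := R^o))
    smoothF).
Qed.

Lemma tmap_cotriv (m1 : dual LG) (m2 : dual LH) (u : tangent G g) (v : tangent
    H h) :
  tmap (cotriv G H) (vec R^o) F p ((m1, m2), (u, v)) =
  (m1 F_mu + m2 F_nu) + (F_g u + F_h v).
Proof.
pose FV (q : prodM (vec (dual LG)) (vec (dual LH))) : vec R^o := F (q, (g, h)).
pose FK (k : mpM G H) : vec R^o := F ((mu, nu), k).
have mFV : mdiff FV (mu, nu) := mdiff_partial1 okV okGH mF.
have mFK : mdiff FK (g, h) := mdiff_partial2 okV okGH mF.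
have E := tmap_prod (K := vec R^o) (f := F) (m1, m2) (u, v) okV okGH mF.
have EV := tmap_prod (f := FV) m1 m2 okV1 okV2 mFV.
have EK := tmap_prod (f := FK) u v okG okH mFK.
have E1 := dual_gradientE m1 reflG (mdiff_partial1 okV1 okV2 mFV).
have E2 := dual_gradientE m2 reflH (mdiff_partial2 okV1 okV2 mFV).
have E3 := covectorE u (mdiff_partial1 okG okH mFK).
have E4 := covectorE v (mdiff_partial2 okG okH mFK).
refine (etrans E (congr2 +%R (etrans EV (congr2 +%R E1 E2))
  (etrans EK (congr2 +%R (esym E3) (esym E4))))).
Qed.

Lemma cotangent_rightE (K : lieGroup R) (k : K) (alpha : dual (tangent K k))
    (xi : lie_algebra K) :
  cotangent_right alpha xi = alpha (tmap K K (fun k' => (k' * k)%g) 1%g xi).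
Proof.
have cl := clinear_comp (tmap_clinear (mdiff_mulr k 1%g)) (clinear_dual alpha).
by rewrite /cotangent_right (to_dualE cl).
Qed.

Lemma cotangent_rhoE (alpha : dual (tangent G g)) (eta : LH) :
  cotangent_rho mp alpha eta = alpha (lact_vg mp eta g).
Proof.
have cl := clinear_comp (tmap_clinear (mdiff_lact_l mp g 1%g)) (clinear_dual
    alpha).
by rewrite /cotangent_rho (to_dualE cl).
Qed.

Lemma star_gE (n : dual LH) (eta : LH) : star_g mp g n eta = n (ract_vg mp eta
    g).
Proof.
have cl := clinear_comp (tmap_clinear (mdiff_ract_l mp g 1%g)) (clinear_dual n).
by rewrite /star_g (to_dualE cl).
Qed.

Lemma star_vE (xi : LG) (n : dual LH) (eta : LH) :
  star_v mp xi n eta = n (ract_vv mp eta xi).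
Proof.
have cl := clinear_comp (ract_vv_clinear1 mp xi) (clinear_dual n).
by rewrite /star_v (to_dualE cl).
Qed.

(** The bracket formula as an identity in arbitrary covectors and vectors. The opposite signs of the
    momenta turn their pairings into those of [a] with [y] minus those of [b] with [x]; the other
    terms expand the matched pair bracket, with [star_v] absorbing the right action. *)
Lemma Omega_opp_right_invariant (a1 b1 m : dual LG) (a2 a3 b2 b3 n : dual LH)
    (x1 y1 : LG) (x2 y2 : LH) (k : mpM G H) :
  Omega mp (right_invariant mp (- (a1, a2 + a3)) (x1, x2) ((m, n), k))
    (right_invariant mp (- (b1, b2 + b3)) (y1, y2) ((m, n), k)) =
  a1 y1 - b1 x1 + m (lie_bracket x1 y1) + a2 y2 - b2 x2 + n (lie_bracket x2 y2)
  + a3 y2 - b3 x2 - star_v mp x1 n y2 + star_v mp y1 n x2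
  + m (lact_vv mp x2 y1) - m (lact_vv mp y2 x1).
Proof.
rewrite Omega_right_invariant !star_vE.
have pN (m1 : dual LG) (m2 m3 : dual LH) xi eta :
    pairing (- ((m1, m2 + m3) : (dual LG * dual LH)%type)) (xi, eta) =
    - (m1 xi + (m2 eta + m3 eta)) by rewrite opprD.
have sum3 (E : normedModType R) (f : dual E) x y z : f (x + y - z) = f x + f y
    - f z.
  by rewrite !(clinear_add _ _ (clinear_dual f)) (clinear_opp _ (clinear_dual
      f)).
rewrite !pN /pairing /= !sum3; ring.
Qed.

(** The pullback of the covector [(F_g, F_h)] by right translation: the transpose of the triangular
    map in [mp_translationE]. *)
Definition mp_cotangent_right : (dual LG * dual LH)%type :=
  (cotangent_right F_g, cotangent_rho mp F_g + star_g mp g (cotangent_right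
      F_h)).

Lemma hamiltonian_fieldE : hamiltonian_field mp F p =
  right_invariant mp (- mp_cotangent_right) (F_mu, F_nu) p.
Proof.
apply: (hamiltonian_field_right_invariant mF) => [[m1 m2]|[xi eta]].
  rewrite (tmap_cotriv m1 m2 0 0).
  by rewrite (clinear0 (clinear_dual F_g)) (clinear0 (clinear_dual F_h)) !addr0.
rewrite mp_translationE (tmap_cotriv 0 0) (clinear_add _ _ (clinear_dual F_g)).
rewrite -cotangent_rightE -cotangent_rhoE -cotangent_rightE -star_gE.
have -> : pairing (- mp_cotangent_right) (xi, eta) = - (cotangent_right F_g xi +
    (cotangent_rho mp F_g eta + star_g mp g (cotangent_right F_h) eta)).
  by rewrite opprD.
have -> : (0 : dual LG) F_mu + (0 : dual LH) F_nu = 0 by exact: addr0.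
by rewrite opprK add0r addrA.
Qed.

End hamiltonian_fields.

Theorem proposition3p2 (R : realType) (G H : lieGroup R) (mp : matchedPair G H)
    (reflG : reflexive_space (lie_algebra G))
    (reflH : reflexive_space (lie_algebra H))
    (HH FF : cotriv G H -> R^o)
    (smoothH : smooth (cotriv G H) (vec R^o) HH)
    (smoothF : smooth (cotriv G H) (vec R^o) FF)
    (mu : dual (lie_algebra G)) (nu : dual (lie_algebra H)) (g : G) (h : H) :
  let H_mu := d_mu HH mu nu g h in let F_mu := d_mu FF mu nu g h in
  let H_nu := d_nu HH mu nu g h in let F_nu := d_nu FF mu nu g h in
  let H_g := d_g HH mu nu g h in let F_g := d_g FF mu nu g h in
  let H_h := d_h HH mu nu g h in let F_h := d_h FF mu nu g h in
  poisson mp HH FF ((mu, nu), (g, h)) =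
    cotangent_right H_g F_mu - cotangent_right F_g H_mu
    + mu (lie_bracket H_mu F_mu)
    + cotangent_rho mp H_g F_nu - cotangent_rho mp F_g H_nu
    + nu (lie_bracket H_nu F_nu)
    + star_g mp g (cotangent_right H_h) F_nu
    - star_g mp g (cotangent_right F_h) H_nu
    - star_v mp H_mu nu F_nu + star_v mp F_mu nu H_nu
    + mu (lact_vv mp H_nu F_mu) - mu (lact_vv mp F_nu H_mu).
Proof.
cbv zeta.
rewrite /poisson (hamiltonian_fieldE mp reflG reflH mu nu g h smoothH).
rewrite (hamiltonian_fieldE mp reflG reflH mu nu g h smoothF).
exact: Omega_opp_right_invariant.
Qed.
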